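(* As $n\to\infty$, the expected number of steps of a grand zigzag knight's path of size $2n$ ending on the $x$-axis, chosen uniformly at random among all such paths, is asymptotically equivalent to $$\frac{1+\sqrt5}{2\sqrt5}\cdot 2n.$$ This expected number of steps is also equal to the expected (total) number of parts of a pair $(X,Y)$ chosen uniformly at random among all pairs of compositions of $n$ with parts in $\{1,2\}$ and having the same number of parts.
   Context: A grand zigzag knight's path is a lattice path in $\mathbb{Z}^2$ starting at the origin, made of steps $N=(1,2)$, $\bar N=(1,-2)$, $E=(2,1)$, $\bar E=(2,-1)$, such that the vertical components of two consecutive steps never have the same direction (up-steps $N,E$ and down-steps $\bar N,\bar E$ alternate). The size is the $x$-coordinate of the last point. A composition of $n$ is a finite sequence of positive integers with sum $n$; the number of parts of a pair $(X,Y)$ is the number of parts of $X$ plus the number of parts of $Y$. *)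

(* Defs.v *)
From HB Require Import structures.
From mathcomp Require Import all_boot all_order all_algebra finmap.
From mathcomp Require Import all_classical all_reals all_analysis.
Import Order.TTheory GRing.Theory Num.Theory.
Import numFieldNormedType.Exports.

Set Implicit Arguments.
Unset Strict Implicit.
Unset Printing Implicit Defensive.

Local Open Scope classical_set_scope.
Local Open Scope ring_scope.

Inductive step := N | Nbar | E | Ebar.

Definition vec (s : step) : int * int :=
  match s with
  | N => (1, 2)
  | Nbar => (1, -2)
  | E => (2, 1)
  | Ebar => (2, -1)
  end.

Definition bools_of_step (s : step) : bool * bool :=
  match s with
  | N => (true, true)
  | Nbar => (true, false)
  | E => (false, true)
  | Ebar => (false, false)
  end.

Definition step_of_bools (b : bool * bool) : step :=
  match b with
  | (true, true) => N
  | (true, false) => Nbar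
  | (false, true) => E
  | (false, false) => Ebar
  end.

Lemma bools_of_stepK : cancel bools_of_step step_of_bools.
Proof. by case. Qed.

HB.instance Definition _ := Finite.copy step (can_type bools_of_stepK).

Definition up (s : step) : bool := 0 < (vec s).2.

(* A path starts at the origin, so it is determined by its list of steps. *)
Definition endpoint (p : seq step) : int * int := \sum_(s <- p) vec s.

Definition path_size (p : seq step) : int := (endpoint p).1.

(* [sorted] only compares consecutive entries. *)
Definition grand_zigzag (p : seq step) : bool :=
  sorted (fun s t => up s != up t) p.

Definition axis_paths (m : nat) : set (seq step) :=
  [set p | [/\ grand_zigzag p, path_size p = m%:Z & (endpoint p).2 = 0]].

Definition composition (n : nat) (c : seq nat) : bool :=
  all (fun i => 0 < i)%N c && (sumn c == n).

Definition composition_pairs (n : nat) : set (seq nat * seq nat) :=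
  [set XY | [/\ composition n XY.1 /\ {subset XY.1 <= [:: 1; 2]%N},
                composition n XY.2 /\ {subset XY.2 <= [:: 1; 2]%N} &
                size XY.1 = size XY.2]].

(* Expectation of [f] under the uniform law on [A]. This is meaningful for
   finite nonempty [A]; the lemmas below show that this covers every use. *)
Definition uniform_mean (R : realType) (T : choiceType) (A : set T)
    (f : T -> nat) : R :=
  (\sum_(x \in A) ((f x)%:R : R)) / #|` fset_set A|%:R.

Definition mean_steps (R : realType) (n : nat) : R :=
  uniform_mean R (axis_paths (2 * n)) size.

Definition mean_parts (R : realType) (n : nat) : R :=
  uniform_mean R (composition_pairs n) (fun XY => size XY.1 + size XY.2)%N.

Lemma finite_bounded_seq (T : finType) (m : nat) :
  finite_set [set s : seq T | (size s <= m)%N].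
Proof.
apply: (@sub_finite_set _ _ (range (fun b : m.-bseq T => val b))).
  by move=> s /= sm; exists (Bseq sm).
exact: finite_image.
Qed.

Lemma size_le_path_size (p : seq step) : (size p)%:Z <= path_size p.
Proof.
rewrite /path_size /endpoint; elim: p => [|s p IHp]; first by rewrite big_nil.
rewrite big_cons /= -addn1 PoszD addrC; apply: lerD => //.
by case: s.
Qed.

Lemma finite_axis_paths (m : nat) : finite_set (axis_paths m).
Proof.
apply: sub_finite_set (finite_bounded_seq step m) => p [_ pm _] /=.
by rewrite -lez_nat -pm size_le_path_size.
Qed.

Lemma axis_paths_nonempty (n : nat) : axis_paths (2 * n) !=set0.
Proof.
pose q := flatten (nseq n [:: N; Nbar]).
have qs : endpoint q = ((2 * n)%N%:Z, 0).
  rewrite /q /endpoint; elim: n {q} => [|n IHn]; first by rewrite big_nil.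
  by rewrite [flatten _]/= !big_cons IHn mulnS.
exists q; split; rewrite /path_size ?qs //.
by rewrite /q /grand_zigzag; elim: n {q qs} => [//|[|n] IHn] //=.
Qed.

Lemma finite_composition_pairs (n : nat) : finite_set (composition_pairs n).
Proof.
pose S := [set c : seq nat | composition n c].
have Sfin : finite_set S.
  have := finite_image (map val) (finite_bounded_seq 'I_n.+1 n).
  apply: sub_finite_set => c /andP[/allP c0 /eqP cn] /=.
  have cle i : i \in c -> (i < n.+1)%N.
    rewrite ltnS -cn; elim: (c) => //= a l IHl.
    rewrite inE => /orP[/eqP->|/IHl il]; first exact: leq_addr.
    exact: leq_trans il (leq_addl _ _).
  exists (map inord c).
    rewrite /= size_map -cn; elim: (c) c0 => //= a l IHl c0.
    rewrite -add1n leq_add ?c0 ?mem_head // IHl // => i il.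
    by rewrite c0 // inE il orbT.
  rewrite -map_comp -[RHS]map_id; apply/eq_in_map => i /cle /= ilt.
  by rewrite inordK.
apply: sub_finite_set (finite_setX Sfin Sfin) => -[X Y] /= [[? _] [? _] _].
by split.
Qed.

Lemma composition_pairs_nonempty (n : nat) : composition_pairs n !=set0.
Proof.
have n1 : composition n (nseq n 1%N) /\ {subset nseq n 1%N <= [:: 1; 2]%N}.
  split; last by move=> i /nseqP[->].
  by rewrite /composition all_nseq orbT sumn_nseq mul1n eqxx.
by exists (nseq n 1%N, nseq n 1%N).
Qed.

(* Main.v *)
(* A path of even size ending on the x-axis has an even number of steps, and
   listing the widths of its steps in odd and in even position gives two
   {1,2}-sequences of equal length; the endpoint is (2n,0) exactly when both have
   sum n. For n > 0 this is two-to-one onto the pairs of compositions, according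
   to the direction of the first step, and preserves the size.
   Choosing which parts equal 2, the number k of parts has weight
   w_k = C(k,n-k)^2 among these pairs, and
     P(k+1)^2 w_{k+1} = Q(k)^2 w_k,  P(k) = (2k-n)(2k-n-1),  Q(k) = (k+1)(n-k).
   Hence E[P(K)^2 g(K) - Q(K)^2 g(K+1)] = 0 for every g. As
   P - Q = 5 (k - c n)(k - (1-c) n) - k with c = (5 + sqrt 5)/10, the choice
   g(k) = k - c n gives E[(K - c n)^2] = O(n), so E K ~ c n. *)

Require Import Defs.
From mathcomp Require Import all_boot all_order all_algebra.
From mathcomp Require Import all_classical all_reals all_analysis.
From mathcomp Require Import ring lra zify.
Import Order.TTheory GRing.Theory Num.Theory.
Import numFieldNormedType.Exports.
Local Open Scope classical_set_scope.
Local Open Scope ring_scope.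

Set Implicit Arguments.
Unset Strict Implicit.

(** * Enumeration of the pairs of compositions with parts in {1,2} *)

Lemma uniform_mean_seq (R : realType) (T : choiceType) (s : seq T)
    (f : T -> nat) :
  uniq s -> uniform_mean R [set` s] f = (\sum_(x <- s) f x)%:R / (size s)%:R.
Proof.
move=> us; rewrite /uniform_mean -fsbig_seq // natr_sum; congr (_ / _%:R).
by rewrite card_fset_sum1 -fsbig_finite // -fsbig_seq // sum1_size.
Qed.

(* The lists of [k] entries in {1,2}, exactly [j] of which equal 2. *)
Fixpoint comps12 (k j : nat) : seq (seq nat) :=
  match k, j with
  | 0%N, 0%N => [:: [::]]
  | 0%N, _.+1 => [::]
  | k'.+1, 0%N => map (cons 1%N) (comps12 k' 0)
  | k'.+1, j'.+1 =>
      map (cons 1%N) (comps12 k' j) ++ map (cons 2%N) (comps12 k' j')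
  end.

Lemma size_comps12 (k j : nat) : size (comps12 k j) = 'C(k, j).
Proof.
elim: k j => [|k IHk] [|j] //=; first by rewrite size_map IHk !bin0.
by rewrite size_cat !size_map !IHk binS.
Qed.

Lemma cons_inj (T : Type) (x : T) : injective (cons x).
Proof. by move=> s t []. Qed.

Lemma uniq_comps12 (k j : nat) : uniq (comps12 k j).
Proof.
elim: k j => [|k IHk] [|j] //=; first by rewrite map_inj_uniq //; exact: cons_inj.
rewrite cat_uniq !map_inj_uniq ?IHk ?andbT /=; try exact: cons_inj.
by apply/hasPn => _ /mapP[s _ ->]; apply/mapP => -[t _].
Qed.

Lemma mem_map_cons (T : eqType) (x y : T) (c : seq T) (s : seq (seq T)) :
  (y :: c \in map (cons x) s) = (y == x) && (c \in s).
Proof.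
apply/mapP/andP => [[t ts [-> ->]]|[/eqP-> cs]]; first by rewrite eqxx.
by exists c.
Qed.

Lemma mem_comps12 (k j : nat) (c : seq nat) :
  (c \in comps12 k j) =
  [&& size c == k, all (mem [:: 1; 2]%N) c & sumn c == (k + j)%N].
Proof.
elim: k j c => [|k IHk] j [|x c].
- by case: j.
- by case: j.
- case: j => [|j] /=; last rewrite mem_cat; rewrite ?orbF;
  do ?[apply/negbTE/negP]; try move=> /orP[]; by move=> /mapP[].
(* For [j = 0] a head equal to 2 would force a tail of length [k] with sum [k - 1]; this bound
   excludes it. *)
have sc : size c == k -> all (mem [:: 1; 2]%N) c -> (k <= sumn c)%N.
  move=> /eqP <-; elim: (c) => //= y d IHd /andP[y12 /IHd].
  by move: y12; rewrite !inE => /orP[] /eqP ->; lia.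
case: j => [|j] /=; rewrite ?mem_cat !mem_map_cons !IHk !inE eqSS;
  case: (boolP (size c == k)) => [/sc {}sc|_]; rewrite ?andbF //=;
  case: (boolP (all _ c)) => [/sc {}sc|_]; rewrite ?andbF ?andbT //=; lia.
Qed.

(** Here [k] is the common number of parts; sum [n] then forces [n - k] parts equal to 2. The
    subtraction never truncates, since [k] ranges up to [n]. *)
Definition comp12_pairs (n : nat) : seq (seq nat * seq nat) :=
  [seq XY | k <- iota 0 n.+1,
            XY <- [seq (X, Y) | X <- comps12 k (n - k),
                           Y <- comps12 k (n - k)]].

Lemma mem_comp12_pairs (n : nat) (XY : seq nat * seq nat) :
  (XY \in comp12_pairs n) =
  [&& size XY.1 == size XY.2, all (mem [:: 1; 2]%N) XY.1,
      all (mem [:: 1; 2]%N) XY.2, sumn XY.1 == n & sumn XY.2 == n].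
Proof.
have size_le c : all (mem [:: 1; 2]%N) c -> (size c <= sumn c)%N.
  elim: c => //= x c IHc /andP[+ /IHc]; rewrite !inE => /orP[] /eqP ->; lia.
case: XY => X Y /=; apply/allpairsPdep/idP => [|].
  move=> [k [XY [+ /allpairsP[[X' Y'] [/= + + ->]] [-> ->]]]].
  rewrite !mem_comps12 mem_iota /=.
  move=> kn /and3P[/eqP sX -> /eqP ->] /and3P[/eqP sY -> /eqP ->].
  by rewrite sX sY /= subnKC ?eqxx.
move=> /and5P[/eqP sXY X12 Y12 /eqP Xn /eqP Yn]; have /[!Xn] sXn := size_le _ X12.
exists (size X), (X, Y); split=> //; first by rewrite mem_iota.
apply/allpairsP; exists (X, Y).
by rewrite !mem_comps12 X12 Y12 Xn Yn sXY subnKC -?sXY ?eqxx.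
Qed.

Lemma uniq_comp12_pairs (n : nat) : uniq (comp12_pairs n).
Proof.
apply: allpairs_uniq_dep; first exact: iota_uniq.
  by move=> k _; apply: allpairs_uniq => [||[? ?] [? ?] _ _ //]; exact: uniq_comps12.
move=> _ _ /allpairsPdep[k [XY [_ XYk ->]]] /allpairsPdep[l [XY' [_ XYl ->]]] /= eXY.
move: XYk XYl; rewrite {}eXY.
move=> /allpairsP[[X Y] [/= + _ ->]] /allpairsP[[X' Y'] [/= + _ [eX _]]].
rewrite -{}eX.
by rewrite !mem_comps12 => /andP[/eqP <- _] /andP[/eqP <- _].
Qed.

(** On the block of index [k] the summand is constant, and the block is a product of two copies of a
    list of length ['C(k, n - k)]. *)
Lemma sum_comp12_pairs (n : nat) (F : nat -> nat) :
  (\sum_(XY <- comp12_pairs n) F (size XY.1) =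
   \sum_(k < n.+1) F k * 'C(k, n - k) ^ 2)%N.
Proof.
rewrite big_allpairs_dep -(big_mkord xpredT (fun k => F k * 'C(k, n - k) ^ 2)%N).
rewrite /index_iota subn0; apply: eq_bigr => k _; rewrite big_allpairs_dep.
rewrite -[in RHS]size_comps12 mulnC -mulnn -mulnA; set s := comps12 _ _.
have sk X : X \in s -> size X = k by rewrite mem_comps12 => /and3P[/eqP].
rewrite big_seq (eq_bigr (fun=> size s * F k)%N); last first.
  by move=> X /sk /= ->; rewrite big_const_seq count_predT iter_addn_0 mulnC.
by rewrite -big_seq big_const_seq count_predT iter_addn_0 mulnC.
Qed.

Lemma composition_pairsE (n : nat) : composition_pairs n = [set` comp12_pairs n].
Proof.
have pos12 c : all (mem [:: 1; 2]%N) c -> all (fun i => 0 < i)%N c.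
  by apply: sub_all => x; rewrite !inE => /orP[] /eqP ->.
apply/seteqP; split=> -[X Y] /=; rewrite mem_comp12_pairs /=.
  move=> [[/andP[_ ->] /allP ->] [/andP[_ ->] /allP ->] ->].
  by rewrite eqxx.
move=> /and5P[/eqP sXY X12 Y12 Xn Yn].
by split=> //; split; rewrite /composition ?pos12 //; exact/allP.
Qed.

Lemma mean_partsE (R : realType) (n : nat) :
  mean_parts R n =
  (2 * \sum_(XY <- comp12_pairs n) size XY.1)%:R / (size (comp12_pairs n))%:R.
Proof.
rewrite /mean_parts composition_pairsE uniform_mean_seq ?uniq_comp12_pairs //.
congr (_%:R / _); rewrite big_distrr /= !big_seq; apply: eq_bigr => XY.
by rewrite mem_comp12_pairs mul2n -addnn => /andP[/eqP ->].
Qed.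

(** * Paths as interleavings of two compositions *)

Definition step_of (u : bool) (x : nat) : step :=
  if u then if x == 1%N then N else E else if x == 1%N then Nbar else Ebar.

(** [X] gives the widths of the steps in odd position, all in direction [u]; [Y] gives those in even
    position, in the opposite direction. *)
Fixpoint weave (u : bool) (X Y : seq nat) : seq step :=
  match X, Y with
  | x :: X', y :: Y' => step_of u x :: step_of (~~ u) y :: weave u X' Y'
  | _, _ => [::]
  end.

Lemma up_step_of (u : bool) (x : nat) : up (step_of u x) = u.
Proof. by rewrite /step_of; case: u; case: ifP. Qed.

Lemma size_weave (u : bool) (X Y : seq nat) :
  size X = size Y -> size (weave u X Y) = (2 * size X)%N.
Proof. by elim: X Y => [|x X IHX] [|y Y] //= [/IHX ->]; rewrite mulnS. Qed.

Lemma path_weave (u : bool) (X Y : seq nat) (s : step) :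
  up s = ~~ u -> path (fun s t => up s != up t) s (weave u X Y).
Proof.
elim: X Y s => [|x X IHX] [|y Y] //= s su.
by rewrite su !up_step_of IHX ?up_step_of //; case: u {IHX su}.
Qed.

Lemma grand_zigzag_weave (u : bool) (X Y : seq nat) : grand_zigzag (weave u X Y).
Proof.
exact: path_sorted (@path_weave u X Y (step_of (~~ u) 1) (up_step_of _ _)).
Qed.

(** A step of width x has height 3 - x up to sign. As [X] and [Y] have the same length, the 3s
    cancel and only the difference of the sums remains. *)
Lemma endpoint_weave (u : bool) (X Y : seq nat) :
  size X = size Y -> all (mem [:: 1; 2]%N) X -> all (mem [:: 1; 2]%N) Y ->
  endpoint (weave u X Y) =
  ((sumn X + sumn Y)%:Z, (-1) ^+ u * ((sumn X)%:Z - (sumn Y)%:Z)).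
Proof.
rewrite /endpoint; elim: X Y => [|x X IHX] [|y Y] //=.
  by rewrite big_nil subrr mulr0.
move=> [sXY] /andP[x12 X12] /andP[y12 Y12].
rewrite !big_cons (IHX _ sXY X12 Y12); move: x12 y12; rewrite !inE.
by move=> /orP[] /eqP -> /orP[] /eqP ->; case: u {IHX};
  congr (_, _) => /=; rewrite ?expr0 ?expr1; lia.
Qed.

Lemma weave_inj (u : bool) (X Y X' Y' : seq nat) :
  size X = size Y -> all (mem [:: 1; 2]%N) X -> all (mem [:: 1; 2]%N) Y ->
  size X' = size Y' -> all (mem [:: 1; 2]%N) X' -> all (mem [:: 1; 2]%N) Y' ->
  weave u X Y = weave u X' Y' -> (X, Y) = (X', Y').
Proof.
have step_of_inj v x x' : x \in [:: 1; 2]%N -> x' \in [:: 1; 2]%N ->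
    step_of v x = step_of v x' -> x = x'.
  by rewrite !inE => /orP[] /eqP -> /orP[] /eqP ->; case: v.
elim: X Y X' Y' => [|x X IHX] [|y Y] [|x' X'] [|y' Y'] //=.
move=> [sXY] /andP[x12 X12] /andP[y12 Y12] [sX'Y'] /andP[x'12 X'12].
move=> /andP[y'12 Y'12] [/step_of_inj -> // /step_of_inj -> // eqw].
by case: (IHX _ _ _ sXY X12 Y12 sX'Y' X'12 Y'12 eqw) => -> ->.
Qed.

Lemma step_of_surj (s : step) :
  exists2 x, x \in [:: 1; 2]%N & s = step_of (up s) x.
Proof. by case: s; [exists 1%N|exists 1%N|exists 2|exists 2]. Qed.

(** The preceding step [s] carries the alternation through an induction that removes two steps of
    [p] at a time. *)
Lemma weave_surj (u : bool) (s : step) (p : seq step) :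
  up s = ~~ u -> path (fun s t => up s != up t) s p -> ~~ odd (size p) ->
  exists X Y, [/\ size X = size Y, all (mem [:: 1; 2]%N) X,
                  all (mem [:: 1; 2]%N) Y & p = weave u X Y].
Proof.
have [m] := ubnP (size p); elim: m s p => // m IHm s [|t [|r p]] //=.
  by exists [::], [::].
rewrite !ltnS negbK => pm su /and3P[st tr zp] op.
have tu : up t = u by move: st; rewrite su; case: (up t); case: u {IHm su}.
have ru : up r = ~~ u by move: tr; rewrite tu; case: (up r); case: u {IHm su tu}.
have [X [Y [sXY X12 Y12 ->]]] := IHm r p (ltnW pm) ru zp op.
have [x x12 ->] := step_of_surj t; have [y y12 ->] := step_of_surj r.
by exists (x :: X), (y :: Y); split; rewrite /= ?sXY ?x12 ?y12 ?tu ?ru.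
Qed.

(* Each step satisfies dx + dy = 1 modulo 2. *)
Lemma even_size_path (p : seq step) (m : nat) :
  endpoint p = ((2 * m)%N%:Z, 0) -> ~~ odd (size p).
Proof.
have : exists d : int, (endpoint p).1 + (endpoint p).2 = (size p)%:Z + 2 * d.
  rewrite /endpoint; elim: p => [|s p [d IHp]]; first by exists 0; rewrite big_nil.
  rewrite big_cons; case: (\sum_(j <- p) vec j) IHp => a b /= IHp.
  case: s; [exists (1 + d)|exists (d - 1)|exists (1 + d)|exists d];
  rewrite /=; lia.
by move=> [d +] e; rewrite e /=; lia.
Qed.

Definition weaves (n : nat) : seq (seq step) :=
  [seq weave u XY.1 XY.2 | u <- [:: true; false], XY <- comp12_pairs n].

Lemma axis_pathsE (n : nat) : (0 < n)%N ->
  axis_paths (2 * n) = [set` weaves n].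
Proof.
move=> n0; apply/seteqP; split=> p /=.
  move=> [zp]; rewrite /path_size => px py.
  have ep : endpoint p = ((2 * n)%N%:Z, 0) by rewrite [LHS]surjective_pairing px py.
  case: p zp px py ep => [|s p] zp px py ep.
    by move: px; rewrite /endpoint big_nil /=; lia.
  (* A fictitious first step of the opposite direction brings the path into the form required by
     [weave_surj]. *)
  have zp' : path (fun s t => up s != up t) (step_of (~~ up s) 1) (s :: p).
    by move: zp; rewrite /grand_zigzag /= up_step_of => ->; case: (up s).
  have [X [Y [sXY X12 Y12 pE]]] := weave_surj (up_step_of _ _) zp' (even_size_path ep).
  apply/allpairsPdep; exists (up s), (X, Y); split=> //; first by case: (up s).
  move: ep; rewrite pE endpoint_weave // => -[exy eyy].
  have : sumn X = n /\ sumn Y = n by move: eyy; case: (up s); rewrite ?expr0 ?expr1; lia.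
  by rewrite mem_comp12_pairs /= sXY X12 Y12 => -[-> ->]; rewrite !eqxx.
move=> /allpairsPdep[u [[X Y] [_ + ->]]]; rewrite mem_comp12_pairs /=.
move=> /and5P[/eqP sXY X12 Y12 /eqP Xn /eqP Yn].
have := endpoint_weave u sXY X12 Y12; rewrite Xn Yn subrr mulr0 => ew.
split; rewrite /path_size ?ew //= ?mul2n ?addnn //; exact: grand_zigzag_weave.
Qed.

(** For positive [n] the first step reveals [u]. At [n = 0] both directions give the empty path, so
    that case is treated apart below. *)
Lemma uniq_weaves (n : nat) : (0 < n)%N -> uniq (weaves n).
Proof.
move=> n0; apply: allpairs_uniq => //; first exact: uniq_comp12_pairs.
move=> _ _ /allpairsP[[u XY] [_ + ->]] /allpairsP[[u' XY'] [_ + ->]] /=.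
rewrite !mem_comp12_pairs /= => /and5P[/eqP sXY X12 Y12 /eqP Xn _].
move=> /and5P[/eqP sX'Y' X'12 Y'12 /eqP X'n _] ew.
case: XY sXY X12 Y12 Xn ew => X Y /= sXY X12 Y12 Xn.
case: XY' sX'Y' X'12 Y'12 X'n => X' Y' /= sX'Y' X'12 Y'12 X'n ew.
have euu' : u = u'.
  move: ew Xn X'n sXY sX'Y' n0; clear.
  case: X Y => [|x X] [|y Y] //=; first by move=> _ <-.
  case: X' Y' => [|x' X'] [|y' Y'] //= [/(congr1 up)].
  by rewrite !up_step_of.
by move: ew; rewrite euu' => /weave_inj -/(_ sXY X12 Y12 sX'Y' X'12 Y'12) ->.
Qed.

Lemma axis_paths0 : axis_paths 0 = [set` [:: [::]]].
Proof.
apply/seteqP; split=> p /=.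
  by move=> [_ p0 _]; have := size_le_path_size p; rewrite p0; case: p {p0}.
by rewrite inE => /eqP ->; split=> //; rewrite /path_size /endpoint big_nil.
Qed.

Lemma mean_steps_parts (R : realType) (n : nat) : mean_steps R n = mean_parts R n.
Proof.
rewrite mean_partsE /mean_steps; have [->|n0] := posnP n.
  by rewrite muln0 axis_paths0 uniform_mean_seq // /comp12_pairs /= !big_cons !big_nil.
rewrite axis_pathsE // uniform_mean_seq ?uniq_weaves //.
rewrite /weaves big_allpairs_dep size_allpairs /= !big_cons big_nil addn0.
have sumE u : (\sum_(XY <- comp12_pairs n) size (weave u XY.1 XY.2) =
               2 * \sum_(XY <- comp12_pairs n) size XY.1)%N.
  rewrite big_distrr /= !big_seq; apply: eq_bigr => XY.
  by rewrite mem_comp12_pairs => /andP[/eqP /size_weave ->].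
(* The two directions double both the total number of steps and the number of paths, so the quotient
   is unchanged. *)
rewrite !sumE addnn -mul2n natrM [(2 * size _)%N%:R]natrM -mulf_div divff.
  by rewrite mul1r.
by rewrite pnatr_eq0.
Qed.

(** * Concentration of the number of parts around c n *)

(** The bracket equals (P + Q)(P - Q) t - Q^2 with P - Q = 5 t y - x. From 8 (P + Q) >= N^2 and 5 y
    >= N, the term in t^2 dominates N^3 t^2 after multiplication by 8. The remaining terms cost at
    most 8 (2 + 1) N^4, whence the constant 24. *)
Lemma second_moment_pointwise (R : realFieldType) (s N x t : R) :
  s ^+ 2 = 5 -> 0 <= s -> 8 <= N -> N <= 2 * x -> x <= N ->
  t = x - (5 + s) / 10 * N ->
  N ^+ 3 * t ^+ 2 <=
  24 * N ^+ 4 + 8 * (((2 * x - N) * (2 * x - N - 1)) ^+ 2 * t -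
                     ((x + 1) * (N - x)) ^+ 2 * (t + 1)).
Proof.
move=> s5 s0 N8 N2x xN tE.
have s1 : 2 <= s by nra.
have s2 : s <= 9/4 by nra.
pose P := (2 * x - N) * (2 * x - N - 1); pose Q := (x + 1) * (N - x).
pose y := x - (5 - s) / 10 * N.
have yN : N <= 5 * y by rewrite /y; nra.
have S1 : N ^+ 2 <= 8 * (P + Q) by rewrite /P /Q; nra.
have S2 : P + Q <= 2 * N ^+ 2 by rewrite /P /Q; nra.
have DE : P - Q = 5 * t * y - x.
  rewrite /P /Q tE /y; apply/eqP; rewrite -subr_eq0; apply/eqP.
  (* The factorization holds only because 5 c (1 - c) = 1, that is, modulo [s ^+ 2 = 5]. *)
  transitivity ((s ^+ 2 - 5) * N ^+ 2 / 20); last by rewrite s5 subrr !mul0r.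
  by field.
have Q0 : 0 <= Q by rewrite /Q; nra.
have QN : Q <= N ^+ 2 by rewrite /Q; nra.
have Q2 : Q ^+ 2 <= N ^+ 4.
  by rewrite (_ : N ^+ 4 = (N ^+ 2) ^+ 2); [nra|ring].
have tN : t <= N by rewrite tE; nra.
have xt : x * t <= N ^+ 2 by nra.
have Sxt : (P + Q) * (x * t) <= 2 * N ^+ 4.
  by rewrite (_ : 2 * N ^+ 4 = (2 * N ^+ 2) * N ^+ 2); [nra|ring].
have St : N ^+ 2 * N <= 8 * (P + Q) * (5 * y) by nra.
have Stt : N ^+ 3 * t ^+ 2 <= 8 * (P + Q) * (5 * y) * t ^+ 2.
  by rewrite ler_wpM2r ?sqr_ge0 // (_ : N ^+ 3 = N ^+ 2 * N) //; ring.
have -> : P ^+ 2 * t - Q ^+ 2 * (t + 1) = (P + Q) * ((P - Q) * t) - Q ^+ 2 by ring.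
rewrite DE.
have -> : (P + Q) * ((5 * t * y - x) * t) =
          (P + Q) * (5 * y) * t ^+ 2 - (P + Q) * (x * t) by ring.
lra.
Qed.

Section Second_moment.
Variables (R : realType) (n : nat).
Let w (k : nat) : R := ('C(k, n - k) ^ 2)%:R.
Let P (x : R) : R := (2 * x - n%:R) * (2 * x - n%:R - 1).
Let Q (x : R) : R := (x + 1) * (n%:R - x).

Let w_ge0 k : 0 <= w k. Proof. exact: ler0n. Qed.

(** With n = k + i + 1, [P] at k + 1 is (k + 1 - i)(k - i) and [Q] at k is (k + 1)(i + 1). Two
    absorption identities for binomials then suffice when i <= k. *)
Lemma binomial_ratio (k : nat) : (k < n)%N ->
  P k.+1%:R * 'C(k.+1, n - k.+1)%:R = Q k%:R * 'C(k, n - k)%:R.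
Proof.
move=> kn; rewrite /P /Q; have [i ->] : exists i, n = (k + i.+1)%N.
  by exists (n - k).-1; lia.
rewrite addKn addnS -addSn addKn.
have down := mul_bin_down k.+1 i; have left := mul_bin_left k i.
move: down left => /= /(congr1 (GRing.natmul (1 : R))).
move=> + /(congr1 (GRing.natmul (1 : R))).
rewrite !natrM; have [ik|] := leqP i k.
  rewrite !natrB ?(leqW ik) // natrD -!natr1 => down left.
  transitivity ((k%:R - i%:R) * ((k%:R + 1 - i%:R) * 'C(k.+1, i)%:R) : R).
    by ring.
  rewrite -down mulrCA -left; ring.
(* At i = k + 1 the left binomial is 1 but [P] vanishes; beyond that both binomials are 0. *)
rewrite leq_eqVlt => /orP[/eqP <- _ _|ki _ _].
  have -> : 2 * k.+1%:R - (k.+1 + k.+1)%:R = 0 :> R by rewrite natrD; ring.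
  by rewrite !mul0r bin_small ?mulr0.
by rewrite !bin_small ?mulr0 //; lia.
Qed.

(** The recurrence for [w] matches each negative term with the next positive one. The unmatched ends
    vanish: [w 0 = 0] because [n] is positive, and [Q] is zero at [n]. *)
Lemma weighted_shift (g : R -> R) : (0 < n)%N ->
  \sum_(k < n.+1) w k * (P k%:R ^+ 2 * g k%:R - Q k%:R ^+ 2 * g (k%:R + 1)) = 0.
Proof.
move=> n0; under eq_bigr do rewrite mulrBr.
rewrite sumrB big_ord_recl [X in _ - X]big_ord_recr /=.
rewrite {1}/w subn0 bin_small ?mul0r ?add0r //.
rewrite /Q subrr mulr0 expr0n mul0r mulr0 addr0.
apply/eqP; rewrite subr_eq0; apply/eqP; apply: eq_bigr => k _.
have -> : bump 0 k = k.+1 by [].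
have e : w k.+1 * P k.+1%:R ^+ 2 = w k * Q k%:R ^+ 2.
  by rewrite /w !natrX -!exprMn mulrC binomial_ratio // mulrC.
by rewrite mulrA e -mulrA -natr1.
Qed.

Lemma second_moment : (8 <= n)%N ->
  \sum_(k < n.+1) w k * (k%:R - (5 + Num.sqrt 5) / 10 * n%:R) ^+ 2 <=
  24 * n%:R * \sum_(k < n.+1) w k.
Proof.
move=> n8; have n0 : 0 < n%:R :> R by rewrite ltr0n; lia.
rewrite -(ler_pM2l (exprn_gt0 3 n0)).
have -> : n%:R ^+ 3 * (24 * n%:R * \sum_(k < n.+1) w k) =
  \sum_(k < n.+1) w k * (24 * n%:R ^+ 4) + 8 * 0.
  by rewrite -mulr_suml; ring.
(* The added zero is replaced by this vanishing sum, so that the inequality can be proved term by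
   term. *)
have := weighted_shift (fun x => x - (5 + Num.sqrt 5) / 10 * n%:R).
move=> /(_ (leq_trans (isT : 0 < 8)%N n8)) ws; rewrite -{}[X in 8 * X]ws.
rewrite !mulr_sumr -[leRHS]big_split /=; apply: ler_sum => k _.
rewrite [leLHS]mulrCA [X in _ <= _ + X]mulrCA -mulrDr.
(* The weight is zero when 2 k < n; otherwise the pointwise bound applies. *)
have [kn|nk] := ltnP (2 * k) n.
  by rewrite /w bin_small ?expr0n ?mul0r //; lia.
rewrite ler_wpM2l // [_ + 1 - _]addrAC.
apply: (@second_moment_pointwise _ (Num.sqrt 5)) => //.
- by rewrite sqr_sqrtr.
- by rewrite (ler_nat _ 8).
- by rewrite -natrM ler_nat.
- by rewrite ler_nat -ltnS.
Qed.

Lemma sum_weight_gt0 : 0 < \sum_(k < n.+1) w k.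
Proof.
by rewrite big_ord_recr /= /w subnn bin0 ltr_wpDl // sumr_ge0.
Qed.

(** The condition on [d] bounds the second moment by (d n)^2 times the total weight, which is then
    passed on to the first moment. *)
Lemma first_moment (d : R) : (8 <= n)%N -> 0 < d -> 24 <= d ^+ 2 * n%:R ->
  `|\sum_(k < n.+1) w k * (k%:R - (5 + Num.sqrt 5) / 10 * n%:R)| <=
  d * n%:R * \sum_(k < n.+1) w k.
Proof.
move=> n8 d0 dn; have n0 : 0 < n%:R :> R by rewrite ltr0n; lia.
have dn0 : 0 < 2 * (d * n%:R) by rewrite !mulr_gt0.
rewrite -(ler_pM2l dn0); apply: le_trans (ler_wpM2l (ltW dn0) (ler_norm_sum _ _ _)) _.
have W0 := sum_weight_gt0; have := second_moment n8.
set W := \sum_(k < n.+1) w k in W0 *; set V := \sum_(k < n.+1) _ => VW.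
apply: (@le_trans _ _ ((d * n%:R) ^+ 2 * W + V)); last first.
  have : 24 * n%:R * W <= (d * n%:R) ^+ 2 * W by rewrite ler_pM2r //; nra.
  nra.
rewrite /W /V !mulr_sumr -big_split /=; apply: ler_sum => k _.
rewrite normrM (ger0_norm (w_ge0 k)) mulrCA [_ ^+ 2 * _]mulrC -mulrDr ler_wpM2l //.
(* AM-GM: 2 d n |t| <= (d n)^2 + t^2 *)
set t := _ - _; rewrite -[t ^+ 2]real_normK ?num_real //.
have := sqr_ge0 (d * n%:R - `|t|); nra.
Qed.
End Second_moment.

(** * The asymptotic equivalence *)

Lemma mean_parts_weight (R : realType) (n : nat) :
  mean_parts R n = 2 * (\sum_(k < n.+1) ('C(k, n - k) ^ 2)%:R * k%:R) /
                   \sum_(k < n.+1) ('C(k, n - k) ^ 2)%:R.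
Proof.
rewrite mean_partsE (sum_comp12_pairs n id) -sum1_size.
rewrite (sum_comp12_pairs n (fun=> 1%N)).
rewrite natrM !natr_sum; congr (_ * _ / _); apply: eq_bigr => k _.
  by rewrite mulnC natrM.
by rewrite mul1n.
Qed.

Unset Implicit Arguments.

Theorem theorem3p4 (R : realType) :
  mean_steps R ~_\oo
    (fun n : nat => (1 + Num.sqrt 5) / (2 * Num.sqrt 5) * (2 * n)%N%:R)
  /\ (forall n : nat, mean_steps R n = mean_parts R n).
Proof.
split; last exact: mean_steps_parts.
have s5 : Num.sqrt 5 ^+ 2 = 5 :> R by rewrite sqr_sqrtr.
have s0 : 0 < Num.sqrt 5 :> R by rewrite sqrtr_gt0.
have kE : (1 + Num.sqrt 5) / (2 * Num.sqrt 5) = (5 + Num.sqrt 5) / 10 :> R.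
  have -> : 5 + Num.sqrt 5 = Num.sqrt 5 * (1 + Num.sqrt 5) :> R.
    by rewrite mulrDr mulr1 -expr2 s5 addrC.
  have -> : 10 = 2 * Num.sqrt 5 ^+ 2 :> R by rewrite s5; ring.
  by field; rewrite gt_eqF.
apply/eqaddoP => e e0; near=> n.
have n8 : (8 <= n)%N by near: n; exact: nbhs_infty_ge.
(* The first moment is used with d = e / 2: the factor 2 in the mean turns this into an error e
   n. *)
have ne : 24 <= (e / 2) ^+ 2 * n%:R.
  rewrite -ler_pdivrMl ?exprn_gt0 ?divr_gt0 //; near: n; exact: nbhs_infty_ger.
have n0 : 0 < n%:R :> R by rewrite ltr0n; lia.
rewrite !fctE mean_steps_parts mean_parts_weight kE natrM.
have W0 := sum_weight_gt0 R n.
have := first_moment n8 (divr_gt0 e0 (ltr0Sn R 1)) ne.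
set W := \sum_(k < n.+1) ('C(k, n - k) ^ 2)%:R in W0 *.
set c := (5 + _) / 10 => fm.
have -> : 2 * (\sum_(k < n.+1) ('C(k, n - k) ^ 2)%:R * k%:R) / W
          - c * (2 * n%:R) =
    2 / W * \sum_(k < n.+1) ('C(k, n - k) ^ 2)%:R * (k%:R - c * n%:R).
  under [in RHS]eq_bigr do rewrite mulrBr.
  by rewrite sumrB -mulr_suml -/W; field; rewrite gt_eqF.
(* Since 2 c >= 1, an error of e n is at most e times the claimed equivalent 2 c n. *)
have c2 : 1 / 2 <= c by rewrite /c; lra.
have c0 : 0 < c by lra.
have W2 : 0 < 2 / W by rewrite divr_gt0.
rewrite normrM (gtr0_norm W2) [X in _ <= _ * X]gtr0_norm ?mulr_gt0 //.
apply: le_trans (ler_wpM2l (ltW W2) fm) _.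
have -> : 2 / W * (e / 2 * n%:R * W) = e * n%:R by field; rewrite gt_eqF.
by rewrite ler_pM2l //; nra.
Unshelve. all: by end_near.
Qed.
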